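(* For each positive integer $n$, let $A$ be the cyclic group of order $2n$ and let $G_n=A\wr S_n$. Then $\alpha(G_n)\le\gamma(G_n)$, and as $n\to\infty$, $$\gamma(G_n)=2+\frac{1+\log 2}{\log n}+O\left(\frac{1}{(\log n)^2}\right).$$
   Context: $\log$ is the natural logarithm. The wreath product $A\wr S_n$ is the semidirect product $S_n\ltimes A^n$, where the symmetric group $S_n$ acts on $A^n$ by permuting the coordinates. For a subset $S$ of a group, $Q(S)=\{s_1s_2^{-1}: s_1,s_2\in S\}$. A group $G$ realizes $\langle n_1,n_2,n_3\rangle$ if there are subsets $S_1,S_2,S_3\subseteq G$ with $|S_i|=n_i$ such that for all $q_i\in Q(S_i)$, if $q_1q_2q_3=1$ then $q_1=q_2=q_3=1$. The pseudo-exponent $\alpha(G)$ of a non-trivial finite group $G$ is the minimum of $\frac{3\log|G|}{\log nmp}$ over all positive integers $n,m,p$ (not all $1$) such that $G$ realizes $\langle n,m,p\rangle$; the pseudo-exponent of the trivial group is $3$. For a finite group $G$, $\gamma(G)$ is defined so that $|G|^{1/\gamma(G)}$ is the maximum character degree of $G$ (the largest dimension of an irreducible complex representation), with $\gamma(G)=\infty$ if $G$ is abelian. *)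

(* Defs.v *)
From HB Require Import structures.
From mathcomp Require Import all_boot all_order all_algebra.
From mathcomp Require Import all_fingroup all_solvable all_field all_character.
From mathcomp Require Import all_classical all_reals all_analysis.

Set Implicit Arguments.
Unset Strict Implicit.
Unset Printing Implicit Defensive.

Import Order.TTheory GRing.Theory Num.Theory.
Import numFieldNormedType.Exports.

Local Open Scope ring_scope.

Section Wreath.
Variables (gT : finGroupType) (n : nat).

(* A^n is the library's external product group, whose group structure is
   attached to {dffun _} rather than to {ffun 'I_n -> gT}.
   s moves the coordinate at position i to position s i; the inverse makes
   this a right action for MathComp's convention (s * t) i = t (s i). *)
Definition coord_perm (f : {dffun forall _ : 'I_n, gT}) (s : 'S_n) :
    {dffun forall _ : 'I_n, gT} :=
  [ffun i => f ((s^-1)%g i)].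

Fact coord_perm_is_action : is_action [set: 'S_n]%SET coord_perm.
Proof.
apply: is_total_action => [f|f s t].
- by apply/ffunP => i; rewrite ffunE invg1 perm1.
- by apply/ffunP => i; rewrite !ffunE invMg permM.
Qed.

Definition coord_perm_action := Action coord_perm_is_action.

Fact coord_perm_is_groupAction :
  is_groupAction [set: {dffun forall _ : 'I_n, gT}]%SET coord_perm_action.
Proof.
move=> s _; rewrite inE; apply/andP; split.
  by apply/fintype.subsetP => f _; rewrite inE.
apply/morphicP => f g _ _; rewrite !actpermE /=.
by apply/ffunP => i; rewrite !ffunE.
Qed.

Definition coord_perm_groupAction := GroupAction coord_perm_is_groupAction.

Definition wreath := sdprod_by coord_perm_groupAction.

Lemma card_wreath : #|[set: wreath]%SET| = (n`! * #|gT| ^ n)%N.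
Proof.
have := sdprod_card (sdprod_sdpair coord_perm_groupAction).
rewrite !card_injm ?injm_sdpair1 ?injm_sdpair2 //= => <-.
by rewrite !cardsT card_ffun card_Sn card_ord mulnC.
Qed.

End Wreath.

Section TripleProduct.
Variable gT : finGroupType.
Implicit Types (G : {group gT}) (S : {set gT}).

Definition right_quotients S : {set gT} :=
  [set (s1 * s2^-1)%g | s1 in S, s2 in S]%SET.

Definition triple_product_property (S1 S2 S3 : {set gT}) : Prop :=
  forall q1 q2 q3 : gT,
    q1 \in right_quotients S1 -> q2 \in right_quotients S2 ->
    q3 \in right_quotients S3 ->
    (q1 * q2 * q3 = 1)%g -> [/\ q1 = 1%g, q2 = 1%g & q3 = 1%g].

Definition realizes G (n1 n2 n3 : nat) : Prop :=
  exists S1 S2 S3 : {set gT},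
    [/\ [/\ S1 \subset G, S2 \subset G & S3 \subset G],
        [/\ #|S1| = n1, #|S2| = n2 & #|S3| = n3]
      & triple_product_property S1 S2 S3].

(* irr_degree (socle_of_Iirr i) is the dimension of the irreducible
   representation 'Chi_i affording 'chi_i; see irr1_degree. *)
Definition max_character_degree G : nat :=
  (\max_(i : Iirr G) irr_degree (socle_of_Iirr i))%N.

End TripleProduct.

Section Exponents.
Variables (R : realType) (gT : finGroupType).
Implicit Type G : {group gT}.

Definition exponent_candidates G : set R :=
  [set x | exists n m p : nat,
    [/\ [&& (0 < n)%N, (0 < m)%N & (0 < p)%N],
        ~~ [&& n == 1%N, m == 1%N & p == 1%N],
        realizes G n m p
      & x = 3 * ln #|G|%:R / ln (n * m * p)%:R]]%classic.

(* For non-trivial G the infimum is a minimum: see pseudo_exponent_min. *)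
Definition pseudo_exponent G : R :=
  if #|G| == 1%N then 3 else inf (exponent_candidates G).

(* The non-abelian branch solves |G|^(1/g) = max degree for g: see
   char_exponent_spec. *)
Definition char_exponent G : \bar R :=
  if abelian G then +oo%E
  else (ln #|G|%:R / ln (max_character_degree G)%:R)%:E.

Lemma realizes_card_le G n m p : realizes G n m p ->
  [/\ (n <= #|G|)%N, (m <= #|G|)%N & (p <= #|G|)%N].
Proof.
move=> [S1 [S2 [S3 [[s1 s2 s3] [<- <- <-] _]]]].
by split; exact: subset_leq_card.
Qed.

Lemma realizes_card G : realizes G #|G| 1 1.
Proof.
exists (G : {set gT}), [set 1%g]%SET, [set 1%g]%SET; split.
- by rewrite subxx sub1G.
- by rewrite cards1.
have Q1 q : q \in right_quotients [set 1%g]%SET -> q = 1%g.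
  by case/imset2P => x y /set1P-> /set1P-> ->; rewrite invg1 mulg1.
by move=> q1 q2 q3 _ /Q1-> /Q1->; rewrite !mulg1.
Qed.

Lemma pseudo_exponent_min G : #|G| != 1%N ->
  exponent_candidates G (pseudo_exponent G) /\
  lbound (exponent_candidates G) (pseudo_exponent G).
Proof.
move=> G1; rewrite /pseudo_exponent (negbTE G1).
have G_gt1 : (1 < #|G|)%N by rewrite ltn_neqAle eq_sym G1 cardG_gt0.
pose P k := `[< exists n m p : nat,
    [/\ [&& (0 < n)%N, (0 < m)%N & (0 < p)%N],
        ~~ [&& n == 1%N, m == 1%N & p == 1%N],
        realizes G n m p & k = (n * m * p)%N] >].
have P1 k : P k -> (1 < k)%N.
  move=> /asboolP[n [m [p [/and3P[n0 m0 p0] N _ ->]]]].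
  rewrite ltn_neqAle !muln_gt0 n0 m0 p0 !andbT eq_sym.
  by apply: contra N; rewrite !muln_eq1 andbA.
have exP : exists k, P k.
  exists #|G|; apply/asboolP; exists #|G|, 1%N, 1%N; split.
  - by rewrite cardG_gt0.
  - by rewrite (negbTE G1).
  - exact: realizes_card.
  - by rewrite !muln1.
have ubP k : P k -> (k <= #|G| * #|G| * #|G|)%N.
  move=> /asboolP[n [m [p [_ _ /realizes_card_le[? ? ?] ->]]]].
  by rewrite !leq_mul.
have [k Pk kmax] := ex_maxnP exP ubP.
pose x : R := 3 * ln #|G|%:R / ln k%:R.
have Ex : exponent_candidates G x.
  move: Pk => /asboolP[n [m [p [H N rel E]]]].
  by exists n, m, p; split => //; rewrite /x E.
have Lx : lbound (exponent_candidates G) x.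
  move=> _ [n [m [p [H N rel ->]]]].
  have Pn : P (n * m * p)%N by apply/asboolP; exists n, m, p.
  rewrite /x; apply: ler_wpM2l.
    by rewrite mulr_ge0 ?ln_ge0 // ler1n cardG_gt0.
  have l0 j : P j -> 0 < ln (j%:R : R).
    by move=> /P1 j1; rewrite ln_gt0 // ltr1n.
  have r0 j : P j -> 0 < (j%:R : R) by move=> /P1 j1; rewrite ltr0n ltnW.
  by rewrite lef_pV2 ?posrE ?l0 // ler_ln ?posrE ?r0 // ler_nat kmax.
suff -> : inf (exponent_candidates G) = x by [].
apply/eqP; rewrite eq_le; apply/andP; split.
- by apply: ge_inf => //; exists x.
- by apply: lb_le_inf => //; exists x.
Qed.

Lemma max_character_degree_gt1 G : ~~ abelian G ->
  (1 < max_character_degree G)%N.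
Proof.
move=> nab; have [d1|//] := leqP (max_character_degree G) 1.
case/negP: nab; apply/char_abelianP => i.
rewrite qualifE /= irr_char irr1_degree /=.
have := leq_trans (leq_bigmax (F := fun i : Iirr G =>
  irr_degree (socle_of_Iirr i)) i) d1.
by have := irr_degree_gt0 (socle_of_Iirr i); case: irr_degree => [|[|]].
Qed.

Lemma char_exponent_spec G (g : R) : ~~ abelian G ->
  (#|G|%:R `^ g^-1 = (max_character_degree G)%:R) <->
  (char_exponent G = g%:E).
Proof.
move=> nab; rewrite /char_exponent (negbTE nab).
have d1 := max_character_degree_gt1 nab.
have lG : ln (#|G|%:R : R) != 0.
  rewrite gt_eqF // ln_gt0 // ltr1n ltn_neqAle cardG_gt0 andbT eq_sym.
  by apply: contra nab => /eqP /card1_trivg ->; exact: abelian1.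
have ld : ln ((max_character_degree G)%:R : R) != 0.
  by rewrite gt_eqF // ln_gt0 // ltr1n.
split=> [E | [<-]].
- congr (_%:E); rewrite -E ln_powR invfM invrK mulrCA divff //.
  by rewrite mulr1.
- apply: ln_inj; rewrite ?posrE ?powR_gt0 ?ltr0n ?cardG_gt0 ?(ltnW d1) //.
  by rewrite ln_powR invf_div divfK.
Qed.

End Exponents.

(* Main.v *)
(* Write G for A wr S_n, with A cyclic of order 2n generated by g.

   The base group A^n is abelian of index n!, so every irreducible degree is at
   most n!.  Conversely A has 2n >= n linear characters; the product of n
   distinct ones, one for each coordinate, is a linear character of A^n whose
   inertia group is A^n itself, so it induces an irreducible character of
   degree n!.  Hence the largest degree is n! and
   gamma(G) = log |G| / log n! = 1 + n log (2n) / log n!, and the asymptotics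
   follow from log n! = n log n - n + O(log n).

   For the pseudo-exponent, take the conjugates of S_n by the elements
   (1)_i, (g^-i)_i and (g^i)_i of A^n.  In coordinates the triple product
   property says: if u, v are permutations with i + u(i) = 2 v(i) mod 2n for all
   i, then u = v = 1.  As 0 <= i < n the congruence is an equality, v(i) is the
   midpoint of i and u(i), and summing the convexity inequality
   v(i)^2 <= (i^2 + u(i)^2) / 2 over all i forces equality, so u = 1.  Thus G
   realizes <n!, n!, n!>, which gives alpha(G) <= log |G| / log n!. *)

Require Import Defs.
From mathcomp Require Import all_boot all_order all_algebra.
From mathcomp Require Import all_fingroup all_solvable.
From mathcomp Require Import all_classical all_reals all_analysis.
From mathcomp Require Import all_field all_character.
From mathcomp Require Import zify ring lra.

Import Order.TTheory GRing.Theory Num.Theory.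
Import numFieldNormedType.Exports.
Local Open Scope ring_scope.

(** * Permutations and midpoints *)

Lemma midpoint_sq (a b c : nat) : (a + b = 2 * c ->
  4 * c ^ 2 <= 2 * (a ^ 2 + b ^ 2) ?= iff (a == b))%N.
Proof.
move=> abc.
have -> : (4 * c ^ 2 = a ^ 2 + b ^ 2 + 2 * (a * b))%N.
  by rewrite -[LHS](expnMn 2 c 2) -abc sqrnD.
have [h1 h2] := nat_Cauchy a b.
by split; [| rewrite -h2]; lia.
Qed.

Lemma midpoint_perm (n : nat) (u v : 'S_n) :
  (forall i : 'I_n, i + u i = 2 * v i)%N -> (u = 1)%g /\ (v = 1)%g.
Proof.
move=> uv.
have sum_sq (w : 'S_n) : (\sum_i (w i : nat) ^ 2 = \sum_(i < n) i ^ 2)%N.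
  by rewrite [RHS](reindex_inj (@perm_inj _ w)).
have /leqifP : (\sum_i 4 * (v i) ^ 2 <= \sum_(i < n) 2 * (i ^ 2 + (u i) ^ 2)
    ?= iff [forall (i : 'I_n | true), (i : nat) == u i])%N.
  by apply: leqif_sum => i _; exact: midpoint_sq.
have -> : (\sum_i 4 * (v i) ^ 2 = \sum_(i < n) 2 * (i ^ 2 + (u i) ^ 2))%N.
  by rewrite -!big_distrr /= big_split /= !sum_sq addnn -mul2n mulnA.
case: ifP => [/forall_inP u1 _|_]; last by rewrite ltnn.
have {}u1 (i : 'I_n) : u i = i by apply/esym/val_inj/eqP; exact: u1.
split; apply/permP => i; rewrite perm1 //.
by apply: val_inj => /=; have := uv i; rewrite u1; lia.
Qed.

(** * Degree bounds and induction from a subgroup *)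

(** By Frobenius reciprocity, ['chi_i] is a constituent of the character induced from a constituent
    of its restriction to [K]. That constituent is linear, so the induced degree is the index. *)
Lemma degree_le_index (gT : finGroupType) (G K : {group gT}) (i : Iirr G) :
  K \subset G -> abelian K -> (irr_degree (socle_of_Iirr i) <= #|G : K|%g)%N.
Proof.
move=> sKG cKK; have [j] := constt_cfRes_irr K i.
rewrite -constt_Ind_Res => /(char1_ge_constt (cfInd_char G (irr_char j))).
have /char_abelianP/(_ j)/lin_char1 j1 := cKK.
by rewrite cfInd1 // j1 mulr1 irr1_degree ler_nat.
Qed.

Lemma max_degree_le (gT : finGroupType) (G K : {group gT}) : K \subset G -> abelian K ->
  (max_character_degree G <= #|G : K|%g)%N.
Proof. by move=> sKG cKK; apply/bigmax_leqP => i _; exact: degree_le_index. Qed.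

Lemma degree_le_max (gT : finGroupType) (G : {group gT}) (chi : 'CF(G)) (d : nat) :
  chi \in irr G -> chi 1%g = d%:R -> (d <= max_character_degree G)%N.
Proof.
move=> /irrP[i ->]; rewrite irr1_degree => /eqP; rewrite eqC_nat => /eqP <-.
exact: (leq_bigmax (F := fun i : Iirr G => irr_degree (socle_of_Iirr i))).
Qed.

(** This is the Clifford correspondence in the case where the inertia group is [K] itself, so that
    ['chi_i] is the irreducible character to induce. *)
Lemma inertia_Ind_irr (gT : finGroupType) (G K : {group gT}) (i : Iirr K) : normal K G ->
  'I_G['chi_i]%g \subset K -> 'Ind[G] 'chi_i \in irr G.
Proof.
move=> nsKG sIK; have [] := constt_Inertia_bijection i nsKG.
have /group_inj-> : 'I_G['chi_i]%g = K.
  by apply/eqP; rewrite finset.eqEsubset sIK sub_Inertia // normal_sub.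
by move=> + _ _ _; rewrite cfInd_id => -> //; rewrite constt_irr !inE.
Qed.

(** * The base group and the conjugates of the top group *)

Section Wreath.
Variables (gT : finGroupType) (n : nat).
Local Notation to := (coord_perm_groupAction gT n).
Local Notation base := (sdpair1 to @* finset.setT)%g.
Local Notation top := (sdpair2 to @* finset.setT)%g.
Local Notation baseT := {dffun forall _ : 'I_n, gT}.

Lemma base_normal : normal base [set: wreath gT n].
Proof. by have [] := sdprod_context (sdprod_sdpair to). Qed.

Lemma index_base : #|[set: wreath gT n] : base|%g = n`!.
Proof.
rewrite -divgS ?finset.subsetT // card_wreath card_injm ?injm_sdpair1 //.
by rewrite cardsT card_ffun card_ord mulnK // expn_gt0 -cardsT cardG_gt0.
Qed.

Lemma base_abelian : abelian [set: gT] -> abelian base.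
Proof.
move=> cTT; apply: morphim_abelian; apply/centsP => x _ y _; apply/ffunP => i.
by rewrite !ffunE (centsP cTT) ?inE.
Qed.

Lemma topJ_fst (x : baseT) (s : 'S_n) :
  ((sdpair2 to s ^ sdpair1 to x)%g : wreath gT n).1 = s.
Proof.
by rewrite /= !val_insubd !inE /= !mulg1 invg1 mul1g.
Qed.

Lemma topJ_snd (x : baseT) (s : 'S_n) i :
  ((sdpair2 to s ^ sdpair1 to x)%g : wreath gT n).2 i
    = ((x ((s^-1)%g i))^-1 * x i)%g.
Proof.
rewrite /= !val_insubd !inE /= !ffunE !mul1g !mulg1 invg1.
by rewrite invg1 perm1.
Qed.

(** * An irreducible character of degree n! *)

Section BaseChar.
Variable w : 'I_n -> Iirr [set: gT].
Hypothesis cTT : abelian [set: gT].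

(** Given as a 1 x 1 representation, the product of the ['chi_(w i)] is at once a character of
    degree 1. *)
Definition base_mx (x : baseT) : 'M[algC]_1 := (\prod_i 'chi_(w i) (x i))%:M.

Lemma base_mx_repr : mx_repr [set: baseT] base_mx.
Proof.
have lin i : 'chi_(w i) \is a linear_char by exact/char_abelianP.
split=> [|x y _ _]; rewrite /base_mx.
  by rewrite big1 // => i _; rewrite ffunE lin_char1.
rewrite -scalar_mxM -big_split; congr (_%:M); apply: eq_bigr => i _ /=.
by rewrite ffunE lin_charM ?inE.
Qed.

Definition base_char : 'CF([set: baseT]) := cfRepr (MxRepresentation base_mx_repr).

Lemma base_charE x : base_char x = \prod_i 'chi_(w i) (x i).
Proof. by rewrite cfunE inE mulr1n mxtrace_scalar. Qed.

Lemma base_char_irr : base_char \in irr [set: baseT].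
Proof.
by apply: lin_char_irr; rewrite qualifE /= cfRepr_char cfRepr1 eqxx.
Qed.

Hypothesis w_inj : injective w.

Local Notation delta i a := (@dfung1 _ (fun _ : 'I_n => gT) i a).

(** Elements supported at one coordinate recover each factor from the product. *)
Lemma base_char_dfung1 (i : 'I_n) (a : gT) :
  base_char (delta i a) = 'chi_(w i) a.
Proof.
have lin j : 'chi_(w j) \is a linear_char by exact/char_abelianP.
rewrite base_charE (bigD1 i) //= dfung1_id big1 ?mulr1 // => j ji.
by rewrite dfung1_dflt ?lin_char1 // eq_sym.
Qed.

Lemma coord_perm_dfung1 (i : 'I_n) (a : gT) (s : 'S_n) :
  coord_perm (delta i a) s = delta (s i) a.
Proof.
apply/ffunP => j; rewrite ffunE; have [<-|ij] := eqVneq (s i) j.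
  by rewrite permK !dfung1_id.
by rewrite !dfung1_dflt // -(inj_eq (@perm_inj _ s)) permKV.
Qed.

Lemma base_isom : isom [set: baseT] base (sdpair1 to).
Proof. by apply/isomP; split => //; exact: injm_sdpair1. Qed.

Local Notation theta := (cfIsom base_isom base_char).

(** Base elements fix theta, so only the permutation part s of y matters. Since s carries
    [delta i a] to [delta (s i) a], invariance gives equal characters at i and s i, and [w_inj]
    yields s i = i. *)
Lemma inertia_base_char : ('I[theta] \subset base)%g.
Proof.
apply/fintype.subsetP => y Iy.
have baseP (x : baseT) : (sdpair1 to x \in base)%g by rewrite mem_morphim ?inE.
have : (sdpair2 to (y : wreath gT n).1 \in 'I[theta])%g.
  rewrite -(groupMr _ (fintype.subsetP (sub_inertia _) _ (baseP (y : wreath gT n).2))).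
  by rewrite -sdpairE.
move: (y : wreath gT n).1 (sdpairE (y : wreath gT n)) => s -> Is.
rewrite groupMr //; suff -> : s = 1%g by rewrite morph1 group1.
apply/permP => i; rewrite perm1; apply/w_inj/irr_inj/cfunP => a.
rewrite -!base_char_dfung1 -coord_perm_dfung1.
rewrite -(cfIsomE base_isom) ?inE // -(cfIsomE base_isom base_char) ?inE //.
rewrite [RHS](esym (inertia_valJ _ Is)) -sdpair_act ?inE //.
Qed.

Lemma wreath_degree_ge : (n`! <= max_character_degree [set: wreath gT n])%N.
Proof.
have /irrP[t def_t] : theta \in irr base.
  by rewrite cfIsom_irr base_char_irr.
apply: (degree_le_max _ _ _ _ (inertia_Ind_irr _ _ _ t base_normal _)).
  by rewrite -def_t finset.subIset // inertia_base_char orbT.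
rewrite cfInd1 ?finset.subsetT // index_base -def_t cfIsom1 cfRepr1 mulr1 //.
Qed.

End BaseChar.

Lemma max_degree_wreath : abelian [set: gT] -> (n <= #|gT|)%N ->
  max_character_degree [set: wreath gT n] = n`!.
Proof.
move=> cTT le_n; apply/eqP; rewrite eqn_leq; apply/andP; split.
  by rewrite -index_base; apply: max_degree_le; rewrite ?finset.subsetT ?base_abelian.
(* An abelian group has as many irreducible characters as elements; the first n of them serve as
   [w]. *)
have le_n' : (n <= Nirr [set: gT])%N.
  by rewrite -[Nirr _]card_ord card_Iirr_abelian // cardsT.
have w_inj : injective (fun i => widen_ord le_n' i).
  by move=> i j /(congr1 val) /= /val_inj.
exact: wreath_degree_ge cTT w_inj.
Qed.

(** * The triple product property in coordinates *)

Lemma wreath_mul3_eq1 (x y z : wreath gT n) : (x * y * z = 1)%g ->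
  (x.1 * y.1 * z.1 = 1)%g /\ forall i,
  (x.2 ((y.1)^-1 ((z.1)^-1 i)) * y.2 ((z.1)^-1 i) * z.2 i = 1)%g.
Proof.
move=> xyz; split; first by have := congr1 (fun u : wreath gT n => u.1) xyz.
move=> i; have /= := congr1 (fun u : wreath gT n => u.2 i) xyz.
by rewrite !ffunE.
Qed.

Lemma wreath_realizes (g : gT) : #[g]%g = (2 * n)%N ->
  realizes [set: wreath gT n] n`! n`! n`!.
Proof.
move=> og.
pose H (x : baseT) : {group wreath gT n} := (top :^ sdpair1 to x)%G.
have cardH x : #|H x| = n`!.
  by rewrite cardJg card_injm ?injm_sdpair2 // cardsT card_Sn.
(* Each [H x] is a subgroup, so its right quotients stay in it. *)
have HP x q : q \in right_quotients (H x) ->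
    exists s, q = (sdpair2 to s ^ sdpair1 to x)%g.
  case/imset2P => q1 q2 Hq1 Hq2 ->.
  have /imsetP[_ /morphimP[s _ _ ->] ->] := groupM Hq1 (groupVr Hq2).
  by exists s.
pose b : baseT := [ffun i : 'I_n => g ^- i]%g; pose c : baseT := [ffun i : 'I_n => g ^+ i]%g.
exists (H 1%g), (H b), (H c); split; rewrite ?finset.subsetT //.
move=> _ _ _ /HP[s ->] /HP[t ->] /HP[r ->] prod1.
have [] := wreath_mul3_eq1 _ _ _ prod1; rewrite !topJ_fst => str coord.
have [] := @midpoint_perm n (r^-1 * t^-1)%g r^-1%g.
  move=> i; have := coord i; rewrite !topJ_snd permM.
  set j := (r^-1)%g i; set k := (t^-1)%g j.
  rewrite !ffunE !invgK invg1 !mul1g => e.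
  have /eqP : (g ^+ (i + k) = g ^+ (2 * j))%g.
    rewrite mul2n -addnn !expgD.
    (* Here [e] reads g^k g^-j g^-j g^i = 1; its left side is inserted after g^i so that [e] can
       erase it. *)
    transitivity (g ^+ i * (g ^+ k * g ^- j * (g ^- j * g ^+ i))
                  * g ^- i * g ^+ j * g ^+ j)%g; last by rewrite e mulg1 mulgV mul1g.
    by rewrite !mulgA mulgK !mulgKV.
  rewrite eq_expg_mod_order og !modn_small; [by move/eqP | | ].
    by have := ltn_ord j; lia.
  by have := ltn_ord i; have := ltn_ord k; lia.
move=> rt1 /eqP; rewrite invg_eq1 => /eqP r1.
move: rt1 str; rewrite r1 invg1 mul1g mulg1 => /eqP; rewrite invg_eq1 => /eqP->.
by rewrite mulg1 => ->; rewrite morph1 !conj1g.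
Qed.

End Wreath.

(** * Estimates for log n! and the error term *)

Section Factorial.
Variable R : realType.
Implicit Types n : nat.

(** Both bounds are ln (1 + x) <= x, at x = -1/(n+1) and at x = 1/n. *)
Lemma lnS_bounds n : (0 < n)%N ->
  ln n%:R + n.+1%:R^-1 <= ln n.+1%:R :> R /\ ln n.+1%:R <= ln n%:R + n%:R^-1 :> R.
Proof.
move=> n0.
have n0' : 0 < n%:R :> R by rewrite ltr0n.
have Sn0 : 0 < n.+1%:R :> R by rewrite ltr0n.
have En : n.+1%:R = n%:R + 1 :> R by rewrite -natr1.
split.
- have : ln (n%:R / n.+1%:R : R) <= - n.+1%:R^-1.
    rewrite (_ : n%:R / n.+1%:R = 1 + (- n.+1%:R^-1)).
      by apply: le_ln1Dx; rewrite ltrN2 invf_lt1 // ltr1n.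
    by rewrite En; field; rewrite -En gt_eqF.
  by rewrite ln_div ?posrE // lerBlDr [- _ + _]addrC lerBrDr.
- have : ln (n.+1%:R / n%:R : R) <= n%:R^-1.
    rewrite (_ : n.+1%:R / n%:R = 1 + n%:R^-1).
      by apply: le_ln1Dx; rewrite (lt_trans (ltrN10 R)) // invr_gt0.
    by rewrite En; field; rewrite gt_eqF.
  by rewrite ln_div ?posrE // lerBlDl.
Qed.

Lemma ln_fact_bounds n : (0 < n)%N ->
  n%:R * ln n%:R - n%:R <= ln (n`!)%:R :> R /\
  ln (n`!)%:R <= (n%:R + 1) * ln n%:R - n%:R + 1 :> R.
Proof.
case: n => // n _; elim: n => [|n [IHl IHu]].
  by rewrite (_ : 1`! = 1)%N // ln1; split; lra.
have [lo up] := lnS_bounds n.+1 isT.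
have n0 : 0 < n.+1%:R :> R by rewrite ltr0n.
have E : n.+2%:R = n.+1%:R + 1 :> R by rewrite -natr1.
rewrite [n.+2`!]factS natrM lnM ?posrE ?ltr0n ?fact_gt0 //.
(* With N = n+1, the upper bound passes to N+1 because (N+1)(ln (N+1) - ln N) >= 1, the lower one
   because N (ln (N+1) - ln N) <= 1. *)
have lo' : n.+2%:R * ln n.+1%:R + 1 <= n.+2%:R * ln n.+2%:R :> R.
  by rewrite -[X in _ + X](@mulfV _ n.+2%:R) ?pnatr_eq0 // -mulrDr ler_wpM2l.
have up' : n.+1%:R * ln n.+2%:R <= n.+1%:R * ln n.+1%:R + 1 :> R.
  by rewrite -[X in _ + X](@mulfV _ n.+1%:R) ?pnatr_eq0 // -mulrDr ler_wpM2l // ltW.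
set a := ln n.+2%:R in lo' up' *; rewrite E in lo' *.
set N := n.+1%:R in lo' up' IHl IHu *; set b := ln N in lo' up' IHl IHu *.
set F := ln _ in IHl IHu *.
by split; lra.
Qed.

(** Apply ln s <= s to s = sqrt n, where ln n = 2 ln s. *)
Lemma ln_sq_le n : (0 < n)%N -> (ln n%:R) ^+ 2 <= 4 * n%:R :> R.
Proof.
move=> n0; have s0 : 0 < Num.sqrt n%:R :> R by rewrite sqrtr_gt0 ltr0n.
have E : n%:R = Num.sqrt n%:R ^+ 2 :> R by rewrite sqr_sqrtr.
have [l0 l1] : 0 <= ln (Num.sqrt n%:R) :> R /\ ln (Num.sqrt n%:R) <= Num.sqrt n%:R :> R.
  split; last exact/ltW/ln_sublinear.
  by rewrite ln_ge0 // -[leLHS]sqrtr1 ler_wsqrtr // ler1n.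
set s := Num.sqrt _ in s0 E l0 l1.
by rewrite E lnXn // -mulr_natl; nra.
Qed.

(* Writing F / n = L - 1 + d, so that 0 <= d <= (L + 1) / n, the error is
   ((1 + ln 2) - d (L + 1 + ln 2)) / (F / n * L); its numerator is bounded
   because L^2 <= 4 n. *)
Lemma exponent_error n (F := ln (n`!)%:R : R) (L := ln n%:R : R) :
  (0 < n)%N -> 2 <= L ->
  `|(F + n%:R * (ln 2 + L)) / F - (2 + (1 + ln 2) / L)| <= 100 / L ^+ 2.
Proof.
move=> n0 L2; have [lo up] := ln_fact_bounds n n0.
have sq := ln_sq_le n n0; rewrite -/L -/F in lo up sq.
have N0 : 0 < n%:R :> R by rewrite ltr0n.
pose N : R := n%:R; rewrite -/N in lo up sq N0 *.
have [c0 c1] : 0 <= ln 2 :> R /\ ln 2 <= 1 :> R.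
  split; first by rewrite ln_ge0 // ler1n.
  by have /le_ln1Dx : -1 < 1 :> R by lra.
set c : R := ln 2 in c0 c1 *.
(* As L >= 2, F >= N (L - 1) >= N L / 2; this turns the numerator bound 50 N below into 100 F /
   L. *)
have FN : N * L <= 2 * F by nra.
have F0 : 0 < F by nra.
have L0 : 0 < L by lra.
have -> : (F + N * (c + L)) / F - (2 + (1 + c) / L)
   = ((N * (c + L) - F) * L - (1 + c) * F) / (F * L).
  by field; rewrite !gt_eqF.
rewrite normrM normfV (gtr0_norm (mulr_gt0 F0 L0)).
rewrite ler_pdivrMr ?mulr_gt0 // (_ : 100 / L ^+ 2 * (F * L) = 100 * F / L); last first.
  by field; rewrite gt_eqF.
have : `|(N * (c + L) - F) * L - (1 + c) * F| <= 50 * N.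
  rewrite ler_norml; apply/andP; split; nra.
move/le_trans; apply.
rewrite ler_pdivlMr //; lra.
Qed.

End Factorial.

(** * The two exponents of the wreath product *)

Lemma char_exponent_wreath (R : realType) (gT : finGroupType) (n : nat) :
  (1 < n)%N -> abelian [set: gT] -> #|gT| = (2 * n)%N ->
  char_exponent R [set: wreath gT n]%G
    = ((ln (n`!)%:R + n%:R * (ln 2 + ln n%:R)) / ln (n`!)%:R)%:E.
Proof.
move=> n1 cTT oT.
have n0 : (0 < n)%N := ltnW n1.
have d : max_character_degree [set: wreath gT n] = n`!.
  by rewrite max_degree_wreath // oT; lia.
(* The group is not abelian, since its largest degree n! exceeds 1. *)
rewrite /char_exponent ifF; last first.
  apply/negP => /char_abelianP lin.
  have : (max_character_degree [set: wreath gT n] <= 1)%N.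
    apply/bigmax_leqP => i _; have /lin_char1 := lin i.
    by rewrite irr1_degree => /eqP; rewrite pnatr_eq1 => /eqP->.
  by rewrite d leqNgt -[1%N]/(1`!) ltn_fact.
rewrite d card_wreath oT natrM lnM ?posrE ?ltr0n ?fact_gt0 ?expn_gt0 ?muln_gt0 ?n0 //.
rewrite natrX lnXn ?ltr0n ?muln_gt0 ?n0 // natrM lnM ?posrE ?ltr0n //.
by rewrite -[_ *+ n]mulr_natl.
Qed.

(** The factor 3 cancels against ln (m^3) = 3 ln m. *)
Lemma pseudo_exponent_le (R : realType) (gT : finGroupType) (G : {group gT}) m :
  (1 < m)%N -> realizes G m m m ->
  pseudo_exponent R G <= ln #|G|%:R / ln m%:R.
Proof.
move=> m1 rG; have [le_mG _ _] := realizes_card_le rG.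
have G1 : #|G| != 1%N by rewrite gtn_eqF // (leq_trans m1).
have [_ lb] := pseudo_exponent_min R G1.
have -> : ln #|G|%:R / ln m%:R = 3 * ln #|G|%:R / ln (m * m * m)%:R :> R.
  have lm : 0 < ln m%:R :> R by rewrite ln_gt0 // ltr1n.
  rewrite !natrM !lnM ?posrE ?mulr_gt0 ?ltr0n ?(ltnW m1) //.
  by field; rewrite gt_eqF //; lra.
apply: lb; exists m, m, m; split => //; first by rewrite (ltnW m1).
by rewrite gtn_eqF.
Qed.

Local Open Scope classical_set_scope.

Theorem theorem7p5 (R : realType) (A : nat -> finGroupType)
    (hA : forall n : nat, (0 < n)%N ->
      cyclic [set: A n]%SET /\ #|[set: A n]%SET| = (2 * n)%N) :
  let G (n : nat) : {group wreath (A n) n} := [set: wreath (A n) n]%G in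
  (forall n : nat, (0 < n)%N ->
    ((pseudo_exponent R (G n))%:E <= char_exponent R (G n))%E) /\
  (exists2 e : nat -> R,
    e =O_\oo (fun n : nat => 1 / ln n%:R ^+ 2) &
    \forall n \near \oo,
      char_exponent R (G n) = (2 + (1 + ln 2) / ln n%:R + e n)%:E).
Proof.
move=> G; split.
- move=> n n0; have [cyc oA] := hA n n0.
  have [n1|n_le1] := ltnP 1 n; last first.
    (* For n = 1 the group has order 2, hence is abelian with infinite gamma. *)
    rewrite /char_exponent ifT ?leey //.
    have oG : #|G n| = 2%N.
      by rewrite card_wreath -cardsT oA (_ : n = 1%N) //; lia.
    by apply/cyclic_abelian/prime_cyclic; rewrite oG.
  have /cyclicP[g Ag] := cyc.
  have og : #[g]%g = (2 * n)%N by rewrite -oA Ag.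
  rewrite /char_exponent; case: ifP => _; first by rewrite leey.
  rewrite lee_fin max_degree_wreath ?cyclic_abelian //; last first.
    by rewrite -cardsT oA; lia.
  apply: pseudo_exponent_le; last exact: wreath_realizes og.
  by rewrite -[1%N]/(1`!) ltn_fact.
pose L n : R := ln n%:R; pose F n : R := ln (n`!)%:R.
exists (fun n => (F n + n%:R * (ln 2 + L n)) / F n - (2 + (1 + ln 2) / L n)).
  apply/eqO_exP; exists 100 => //; near=> n.
  (* The threshold e^2 supplies the hypothesis ln n >= 2 of [exponent_error]. *)
  have n_big : expR 2 <= n%:R :> R by near: n; exact: nbhs_infty_ger.
  have n0 : (0 < n)%N by rewrite -(ltr0n R) (lt_le_trans (expR_gt0 2)).
  have L2 : 2 <= ln n%:R :> R.
    by rewrite -[leLHS]expRK ler_ln ?posrE ?expR_gt0 // ltr0n.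
  rewrite [X in _ <= _ * X]ger0_norm ?divr_ge0 ?sqr_ge0 // div1r.
  exact: exponent_error.
near=> n.
have n1 : (1 < n)%N by near: n; exact: nbhs_infty_gt.
have [cyc oA] := hA n (ltnW n1).
rewrite /G char_exponent_wreath ?cyclic_abelian //; last by rewrite -cardsT oA.
by congr (_%:E); rewrite [RHS]addrC subrK.
Unshelve. all: by end_near.
Qed.
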